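(* Let $\Omega\subset\mathbb{R}^d$ be bounded and measurable with $|\Omega|>0$, and let $\{E_\lambda\}_{\lambda\in\Sigma}$ be a family of finite-dimensional subspaces of $L^2(\Omega)$. Suppose that there are integers $K,N_{\mathrm{mod}}\geq 1$ such that for every $\lambda\in\Sigma$, $$E_\lambda=\sum_{\mathfrak{c}\in\mathcal{I}(\lambda)}\mathcal{R}_{\mathfrak{c}},$$ where $\mathcal{I}(\lambda)$ is an index set with $\#\mathcal{I}(\lambda)\leq K$ and each $\mathcal{R}_{\mathfrak{c}}$ is a subspace of $L^2(\Omega)$ with $\mathfrak{F}_\Omega(\mathcal{R}_{\mathfrak{c}})\leq N_{\mathrm{mod}}$, uniformly in $\lambda$ and $\mathfrak{c}$. Then $$\mathfrak{F}_\Omega(E_\lambda)\leq N_{\mathrm{mod}}K\qquad\text{for every }\lambda\in\Sigma,$$ and consequently, for every measurable $V\subset\Omega$ with $|V|>0$, $$\|u\|_{L^2(V)}^2\ \geq\ \gamma_{\Omega,V,N_{\mathrm{mod}}K}\,\|u\|_{L^2(\Omega)}^2\qquad\text{for every }\lambda\in\Sigma\text{ and every }u\in E_\lambda,$$ where $\gamma_{\Omega,V,N_{\mathrm{mod}}K}>0$ is a constant depending only on $\Omega$, $V$ and the integer $N_{\mathrm{mod}}K$.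
   Context: For a finite-dimensional subspace $E\subset L^2(\Omega)$ (complex-valued functions), its plane-wave complexity is $$\mathfrak{F}_\Omega(E):=\inf\Bigl\{N\in\mathbb{N}:\ E\subset\operatorname{span}\{e^{i\xi_1\cdot x},\dots,e^{i\xi_N\cdot x}\}\big|_\Omega\text{ for some }\xi_1,\dots,\xi_N\in\mathbb{R}^d\Bigr\},$$ with the convention $\mathfrak{F}_\Omega(E)=\infty$ if no such finite representation exists. The frequencies may depend on $E$; only their number is measured. $|\cdot|$ is Lebesgue measure. *)

(* Defs.v *)
From HB Require Import structures.
From mathcomp Require Import all_boot all_order all_algebra.
From mathcomp Require Import generic_quotient ring_quotient complex.
From mathcomp Require Import all_classical all_reals all_analysis.
From mathcomp Require Import measurable_realfun.
From mathcomp Require Import ring.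

Set Implicit Arguments.
Unset Strict Implicit.
Unset Printing Implicit Defensive.

Import Order.TTheory GRing.Theory Num.Theory.
Import numFieldNormedType.Exports.

Local Open Scope classical_set_scope.
Local Open Scope ring_scope.

Section BorelLebesgueMeasure.
Context {R : realType}.
Local Notation tupR d := (d.-tuple (measurableTypeR R)).

Definition cons_pair d (p : measurableTypeR R * tupR d) : tupR d.+1 :=
  [tuple of p.1 :: p.2].

Lemma measurable_cons_pair d : measurable_fun [set: _] (@cons_pair d).
Proof. exact: measurable_cons. Qed.

Section step.
Variables (d : nat) (m : {sigma_finite_measure set (tupR d) -> \bar R}).

Definition product_cons : set (tupR d.+1) -> \bar R :=
  pushforward (lebesgue_measure \x m)%E (@cons_pair d).

HB.instance Definition _ := Measure.copy product_cons
  (measure_function_pushforward__canonical__measure_function_Measure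
    (lebesgue_measure \x m)%E (@measurable_cons_pair d)).

Lemma product_cons_sigma_finite : sigma_finite setT product_cons.
Proof.
pose uncons (t : tupR d.+1) : measurableTypeR R * tupR d :=
  (thead t, [tuple of behead t]).
have unconsK p : uncons (cons_pair p) = p.
  by case: p => x v; congr pair; apply: val_inj.
have munc : measurable_fun setT uncons.
  by apply: measurable_fun_pair;
    [exact: measurable_tnth | exact: measurable_behead].
have /sigma_finiteP[F [FT ndF Foo]] := sigma_finiteT (@lebesgue_measure R).
have /sigma_finiteP[G [GT ndG Goo]] := sigma_finiteT m.
exists (fun n => uncons @^-1` (F n `*` G n)).
  apply/seteqP; split=> // t _.
  have : [set: _] (uncons t).1 by [].
  rewrite FT => -[i _ Fi].
  have : [set: _] (uncons t).2 by [].
  rewrite GT => -[j _ Gj].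
  exists (maxn i j) => //; split.
    by apply: (subsetPset _ _ (ndF _ _ (leq_maxl i j))).
  by apply: (subsetPset _ _ (ndG _ _ (leq_maxr i j))).
move=> n; have [mF Fnoo] := Foo n; have [mG Gnoo] := Goo n; split.
  by rewrite -[X in measurable X]setTI; apply: munc => //; exact: measurableX.
rewrite /product_cons /pushforward -comp_preimage.
rewrite (_ : uncons \o _ = id); last by apply/funext => p; exact: unconsK.
by rewrite preimage_id product_measure1E// lte_mul_pinfty// ge0_fin_numE.
Qed.

HB.instance Definition _ :=
  Measure_isSigmaFinite.Build _ _ _ product_cons product_cons_sigma_finite.
End step.

(* The d-fold product of the one-dimensional Lebesgue measure on the Borel sets
   of R^d; the values on measurable boxes are computed in borel_lebesgueX. *)
Fixpoint borel_lebesgue d : {sigma_finite_measure set (tupR d) -> \bar R} :=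
  match d with
  | 0 => \d_([tuple] : tupR 0)
  | d'.+1 => product_cons (borel_lebesgue d')
  end.

Lemma measurable_box d (A : 'I_d -> set (measurableTypeR R)) :
  (forall i, measurable (A i)) ->
  measurable [set t : tupR d | forall i, A i (tnth t i)].
Proof.
move=> mA.
have -> : [set t : tupR d | forall i, A i (tnth t i)] =
    \bigcap_(i in [set: 'I_d]) ((@tnth d _)^~ i @^-1` A i).
  by apply/seteqP; split=> t /= At i => [_|]; exact: At.
apply: fin_bigcap_measurable => // i _.
by rewrite -[X in measurable X]setTI; exact: measurable_tnth.
Qed.

Lemma borel_lebesgueX d (A : 'I_d -> set (measurableTypeR R)) :
  (forall i, measurable (A i)) ->
  borel_lebesgue d [set t | forall i, A i (tnth t i)] =
    (\prod_(i < d) lebesgue_measure (A i))%E.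
Proof.
elim: d A => [|d IH] A mA /=.
  rewrite big_ord0 diracE mem_set//=; by case.
rewrite big_ord_recl -IH// -product_measure1E//; last first.
  exact: (@measurable_box d (fun i => A (lift ord0 i)) (fun i => mA _)).
rewrite /product_cons /pushforward.
congr product_measure1; apply/seteqP; split=> -[x v] /= Axv.
  split; first exact: (Axv ord0).
  by move=> i; have := Axv (lift ord0 i); rewrite tnthS.
move=> i; case: (unliftP ord0 i) => [j|] ->; last exact: Axv.1.
by rewrite tnthS; exact: Axv.2.
Qed.
End BorelLebesgueMeasure.

Definition sqnormc {R : realType} (z : R[i]) : R := Normc.normc z ^+ 2.

Section ComplexL2.
Local Open Scope quotient_scope.
Context {d} {T : measurableType d} {R : realType}.
Variable mu : {measure set T -> \bar R}.

Definition sqL2norm (D : set T) (f : T -> R[i]) : \bar R :=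
  (\int[mu]_(x in D) (sqnormc (f x))%:E)%E.

Variables (D : set T) (mD : measurable D).

(* Functions are total on T, but only their restriction to D matters. The proof
   that D is measurable is a parameter because closure under sums needs it. *)
Definition L2pred of measurable D : {pred T -> R[i]} :=
  mem [set f | [/\ measurable_fun D (fun x => complex.Re (f x)),
                   measurable_fun D (fun x => complex.Im (f x)) &
                   (sqL2norm D f < +oo)%E]].

Let sqnormcE (z : R[i]) : sqnormc z = complex.Re z ^+ 2 + complex.Im z ^+ 2.
Proof. by case: z => a b; rewrite /sqnormc /Normc.normc sqr_sqrtr// addr_ge0 ?sqr_ge0. Qed.

Let ReDM (a z w : R[i]) : complex.Re (a * z + w) =
  complex.Re a * complex.Re z - complex.Im a * complex.Im z + complex.Re w.
Proof. by case: a z w => [? ?] [? ?] [? ?]. Qed.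

Let ImDM (a z w : R[i]) : complex.Im (a * z + w) =
  complex.Re a * complex.Im z + complex.Im a * complex.Re z + complex.Im w.
Proof. by case: a z w => [? ?] [? ?] [? ?]. Qed.

Let measurable_sqnormc (f : T -> R[i]) :
  measurable_fun D (fun x => complex.Re (f x)) ->
  measurable_fun D (fun x => complex.Im (f x)) ->
  measurable_fun D (fun x => (sqnormc (f x))%:E).
Proof.
move=> mr mi; apply/measurable_EFinP.
under eq_fun do rewrite sqnormcE.
by apply: measurable_funD; exact: measurable_funX.
Qed.

Lemma L2pred_submod_closed : submod_closed (L2pred mD).
Proof.
split.
  rewrite inE; split; [exact: measurable_cst..|].
  rewrite /sqL2norm integral0_eq// => x _.
  by rewrite /sqnormc Normc.normc0 expr0n.
move=> a f g; rewrite !inE => -[fr fi fo] [gr gi go].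
have afr x : complex.Re ((a *: f + g) x) = complex.Re a * complex.Re (f x) - complex.Im a * complex.Im (f x) + complex.Re (g x).
  exact: ReDM.
have afi x : complex.Im ((a *: f + g) x) = complex.Re a * complex.Im (f x) + complex.Im a * complex.Re (f x) + complex.Im (g x).
  exact: ImDM.
have mfr : measurable_fun D (fun x => complex.Re ((a *: f + g) x)).
  under eq_fun do rewrite afr.
  apply: measurable_funD => //; apply: measurable_funB; exact: measurable_funM.
have mfi : measurable_fun D (fun x => complex.Im ((a *: f + g) x)).
  under eq_fun do rewrite afi.
  apply: measurable_funD => //; apply: measurable_funD; exact: measurable_funM.
split=> //.
pose c := 2 * sqnormc a.
have c0 : 0 <= c by rewrite mulr_ge0// sqr_ge0.
apply: (@le_lt_trans _ _ (c%:E * sqL2norm D f + 2%:E * sqL2norm D g)%E); last first.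
  by rewrite lte_add_pinfty// lte_mul_pinfty// lee_fin.
have sq0 (h : T -> R[i]) x : D x -> (0 <= (sqnormc (h x))%:E)%E.
  by move=> _; rewrite lee_fin sqr_ge0.
rewrite /sqL2norm -!ge0_integralZl//; try exact: measurable_sqnormc;
  try by move=> x Dx; exact: sq0.
rewrite -ge0_integralD//; first last.
- by apply: measurable_funeM; exact: measurable_sqnormc.
- by move=> x Dx; rewrite mule_ge0// ?lee_fin// sqr_ge0.
- by apply: measurable_funeM; exact: measurable_sqnormc.
- by move=> x Dx; rewrite mule_ge0// ?lee_fin// sqr_ge0.
apply: ge0_le_integral => //; try by move=> x Dx; exact: sq0.
- exact: measurable_sqnormc.
- by apply: emeasurable_funD; apply: measurable_funeM; exact: measurable_sqnormc.
move=> x _; rewrite -!EFinM -EFinD lee_fin.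
rewrite /c !sqnormcE afr afi.
move: (complex.Re a) (complex.Im a) (complex.Re (f x)) (complex.Im (f x)) (complex.Re (g x)) (complex.Im (g x)) => p q r s u v.
have -> : 2 * (p ^+ 2 + q ^+ 2) * (r ^+ 2 + s ^+ 2) + 2 * (u ^+ 2 + v ^+ 2) =
  ((p * r - q * s + u) ^+ 2 + (p * s + q * r + v) ^+ 2) +
  ((p * r - q * s - u) ^+ 2 + (p * s + q * r - v) ^+ 2) by ring.
by rewrite lerDl addr_ge0// sqr_ge0.
Qed.

HB.instance Definition _ :=
  GRing.isSubmodClosed.Build _ _ (L2pred mD) L2pred_submod_closed.

Record L2fun := MkL2fun {
  L2fun_val :> T -> R[i] ;
  _ : L2fun_val \in L2pred mD }.

HB.instance Definition _ := [isSub for L2fun_val].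
HB.instance Definition _ := [Choice of L2fun by <:].
HB.instance Definition _ := [SubChoice_isSubLmodule of L2fun by <:].

Definition L2null : {pred L2fun} :=
  mem [set f : L2fun | (f : T -> R[i]) = cst 0 %[ae mu in D]].

Lemma L2null_submod_closed : submod_closed L2null.
Proof.
split.
  by rewrite inE; apply: aeW => x Dx.
move=> a f g; rewrite !inE => f0 g0.
near=> x => Dx.
rewrite (_ : L2fun_val _ x = a * L2fun_val f x + L2fun_val g x)//.
have -> : L2fun_val f x = 0 by apply: (near f0 x).
have -> : L2fun_val g x = 0 by apply: (near g0 x).
by rewrite mulr0 addr0.
Unshelve. all: by end_near. Qed.

HB.instance Definition _ :=
  GRing.isSubmodClosed.Build _ _ L2null L2null_submod_closed.

(* L2 mu mD is the space L^2(D, mu; C) of classes modulo equality mu-almost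
   everywhere on D. *)
Definition L2 : Type := Quotient.quot L2null.
HB.instance Definition _ := GRing.Zmodule.on L2.
HB.instance Definition _ := EqQuotient.on L2.

Definition L2scale (a : R[i]) (u : L2) : L2 := \pi_L2 (a *: repr u).

Lemma L2scale_pi a (f : L2fun) : L2scale a (\pi_L2 f) = \pi_L2 (a *: f).
Proof.
apply/eqP; rewrite -Quotient.idealrBE -scalerBr rpredZ//.
by rewrite Quotient.idealrBE reprK.
Qed.

Lemma L2_piD (f g : L2fun) : \pi_L2 (f + g) = \pi_L2 f + \pi_L2 g.
Proof. exact: (@Quotient.pi_add _ L2null f g). Qed.

Lemma L2scaleA a b u : L2scale a (L2scale b u) = L2scale (a * b) u.
Proof. by rewrite -[u]reprK !L2scale_pi scalerA reprK. Qed.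

Lemma L2scale1 : left_id 1 L2scale.
Proof. by move=> u; rewrite -[u]reprK L2scale_pi scale1r. Qed.

Lemma L2scaleDr : right_distributive L2scale +%R.
Proof.
move=> a u v; rewrite -[u]reprK -[v]reprK -L2_piD !L2scale_pi.
by rewrite scalerDr L2_piD.
Qed.

Lemma L2scaleDl u : {morph L2scale^~ u : a b / a + b}.
Proof. by move=> a b; rewrite -[u]reprK !L2scale_pi scalerDl L2_piD. Qed.

HB.instance Definition _ := GRing.Zmodule_isLmodule.Build R[i] L2
  L2scaleA L2scale1 L2scaleDr L2scaleDl.

(* An arbitrary representative. *)
Definition L2_to_fun (u : L2) : T -> R[i] := L2fun_val (repr u).
Coercion L2_to_fun : L2 >-> Funclass.

End ComplexL2.

Section LinearAlgebra.
Context {K : fieldType} {V : lmodType K}.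

Definition finite_dimensional (E : set V) : Prop :=
  exists (n : nat) (b : 'I_n -> V),
    E = [set u | exists c : 'I_n -> K, u = \sum_i c i *: b i].

Definition sum_of_subspaces (I : finType) (F : I -> set V) : set V :=
  [set u | exists r : I -> V, (forall i, F i (r i)) /\ u = \sum_i r i].
End LinearAlgebra.

Section Euclidean.
Variables (R : realType) (d : nat).

(* R^d with the sigma-algebra of Lebesgue measurable sets, that is, the
   Caratheodory measurable sets of the outer measure of borel_lebesgue. *)
Definition euclidean : measurableType _ :=
  caratheodory_type (mu_ext (@borel_lebesgue R d)).

Definition lebesgue : {measure set euclidean -> \bar R} :=
  @completed_measure_extension _ _ R (@borel_lebesgue R d).

Definition ecoord (x : euclidean) (i : 'I_d) : R := @tnth d R x i.

Definition ebounded (A : set euclidean) : Prop :=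
  exists M : R, forall x, A x -> forall i, `|ecoord x i| <= M.

Lemma lebesgue_box (A : 'I_d -> set (measurableTypeR R)) :
  (forall i, measurable (A i)) ->
  lebesgue [set x | forall i, A i (ecoord x i)] =
    (\prod_(i < d) lebesgue_measure (A i))%E.
Proof.
move=> mA; rewrite -(borel_lebesgueX mA).
by apply: measurable_mu_extE; exact: measurable_box.
Qed.

Definition edot (xi x : euclidean) : R := \sum_(i < d) ecoord xi i * ecoord x i.

Definition planewave (xi x : euclidean) : R[i] :=
  Complex (cos (edot xi x)) (sin (edot xi x)).

Section complexity.
(* Neither definition requires the frequencies to be distinct, and N = 0 is
   allowed; ereal_inf set0 = +oo is the convention for the absence of a finite
   representation. *)
Variables (Omega : set euclidean) (mOmega : measurable Omega).

Definition planewave_span (N : nat) (xi : 'I_N -> euclidean) :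
    set (L2 lebesgue mOmega) :=
  [set u | exists c : 'I_N -> R[i],
     (u : euclidean -> R[i]) = (fun x => \sum_(j < N) c j * planewave (xi j) x)
     %[ae lebesgue in Omega]].

Definition planewave_complexity (E : set (L2 lebesgue mOmega)) : \bar R :=
  ereal_inf [set N%:R%:E | N in [set N : nat |
    exists xi : 'I_N -> euclidean, E `<=` planewave_span xi]].
End complexity.
End Euclidean.

(* Main.v *)
Require Import Defs.
From mathcomp Require Import all_boot all_order all_algebra.
From mathcomp Require Import generic_quotient ring_quotient complex.
From mathcomp Require Import all_classical all_reals all_analysis.
From mathcomp Require Import measurable_realfun ring lra.
Set Implicit Arguments.
Unset Strict Implicit.
Unset Printing Implicit Defensive.
Import Order.TTheory GRing.Theory Num.Theory.
Import numFieldNormedType.Exports.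
Local Open Scope classical_set_scope.
Local Open Scope ring_scope.

(* A sum p of M plane waves is, along any arithmetic progression x + k h, a sum
   of M powers of unimodular numbers, so |p(x)| is bounded by its values at M
   consecutive later points of the progression, with a constant that does not
   depend on the frequencies.  On the line, if W fills most of an interval, the
   Markov inequality leaves only few points of the interval where |p|^2 exceeds
   a multiple of its integral over W; some progression from x through the
   interval avoids them all, and this bounds |p(x)|^2 by the integral.  By the
   Lebesgue density theorem every set of positive measure fills most of some
   interval with rational endpoints; as there are countably many such intervals,
   a set of positive measure in R^(d+1) has slices filling most of one and the
   same interval for a non-null set of base points, and Tonelli's theorem gives
   the bound in dimension d+1 by induction.  The complexity bound is the union
   of the frequency lists of the modes. *)

(** * Extrapolation of sums of powers of unimodular numbers *)

Section Turan.
Context {R : realType}.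
Implicit Types (z w : R[i]) (m : R).

Lemma sqnormcE z : sqnormc z = complex.Re z ^+ 2 + complex.Im z ^+ 2.
Proof.
by case: z => a b; rewrite /sqnormc /Normc.normc sqr_sqrtr// addr_ge0 ?sqr_ge0.
Qed.

Lemma sqnormc_ge0 z : 0 <= sqnormc z.
Proof. exact: sqr_ge0. Qed.

Lemma sqnormcM z w : sqnormc (z * w) = sqnormc z * sqnormc w.
Proof. by rewrite /sqnormc Normc.normcM exprMn. Qed.

Lemma sqnormcB_le z w : sqnormc (z - w) <= 2 * sqnormc z + 2 * sqnormc w.
Proof.
rewrite !sqnormcE; case: z w => [a b] [c e] /=.
have := sqr_ge0 (a + c); have := sqr_ge0 (b + e); nra.
Qed.

(* The sequence [a k = \sum_j b j * z j ^+ k] satisfies a linear recurrence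
   whose coefficients are bounded independently of [z]; here this is obtained
   by applying the induction hypothesis to [a k.+1 - z 0 * a k], in which the
   frequency [z 0] is absent. *)
Lemma turan_extrapolate1 M (b z : 'I_M -> R[i]) m :
  (forall j, sqnormc (z j) = 1) -> 0 <= m ->
  (forall k, (0 < k <= M)%N -> sqnormc (\sum_j b j * z j ^+ k) <= m) ->
  sqnormc (\sum_j b j) <= 10 ^+ M * m.
Proof.
elim: M b z m => [|M IH] b z m z1 m0 am.
  by rewrite big_ord0 /sqnormc Normc.normc0 expr0n/= mul1r.
pose a k := \sum_j b j * z j ^+ k.
pose B j := b (lift ord0 j) * (z (lift ord0 j) - z ord0).
have aB k : a k.+1 - z ord0 * a k = \sum_j B j * z (lift ord0 j) ^+ k.
  rewrite /a !big_ord_recl mulrDr mulr_sumr opprD addrACA exprS.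
  rewrite [X in X + _](_ : _ = 0) ?add0r; last by ring.
  rewrite -sumrB; apply: eq_bigr => j _; rewrite /B exprS; ring.
have B0 : sqnormc (\sum_j B j) <= 10 ^+ M * (4 * m).
  apply: (IH B (fun j => z (lift ord0 j))) => [j||k /andP[k0 kM]].
  - exact: z1.
  - by rewrite mulr_ge0.
  - rewrite -aB; apply: (le_trans (sqnormcB_le _ _)).
    rewrite sqnormcM z1 mul1r.
    have := am k; rewrite k0 (leq_trans kM)// => /(_ isT).
    have := am k.+1; rewrite !ltnS kM => /(_ isT).
    rewrite -/(a k) -/(a k.+1); lra.
have a0E : a 0%N = \sum_j b j by apply: eq_bigr => j _; rewrite expr0 mulr1.
rewrite -a0E (_ : sqnormc _ = sqnormc (z ord0 * a 0%N)); last first.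
  by rewrite sqnormcM z1 mul1r.
have -> : z ord0 * a 0%N = a 1%N - \sum_j B j.
  have := aB 0%N; under [RHS]eq_bigr do rewrite expr0 mulr1.
  by move=> <-; rewrite subKr.
(* The two terms contribute [2 * m] and [2 * (10 ^+ M * (4 * m))], together at most
   [10 * 10 ^+ M * m]; this fixes the base 10. *)
apply: (le_trans (sqnormcB_le _ _)).
have := am 1%N isT; rewrite -/(a 1%N) => a1m.
have p1 : 1 <= 10 ^+ M :> R by rewrite exprn_ege1// ler1n.
have mM : m <= 10 ^+ M * m by rewrite ler_peMl.
rewrite exprS; lra.
Qed.

(** Extrapolation runs backwards one index at a time: replacing [b j] by [b j * z j] shifts the
    sequence, and each of the [N.+1] steps down to index 0 costs a factor [10 ^+ M]. *)
Lemma turan_extrapolate M N (b z : 'I_M -> R[i]) m :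
  (forall j, sqnormc (z j) = 1) -> 0 <= m ->
  (forall k, (0 < k <= M)%N -> sqnormc (\sum_j b j * z j ^+ (N + k)) <= m) ->
  forall k, (k <= N + M)%N ->
    sqnormc (\sum_j b j * z j ^+ k) <= (10 ^+ M) ^+ N.+1 * m.
Proof.
move=> z1 m0; elim: N b => [|N IH] b am.
  move=> [_|k kM]; last first.
    rewrite expr1 (le_trans (am k.+1 _))// ler_peMl// exprn_ege1// ler1n//.
  under eq_bigr do rewrite expr0 mulr1.
  by rewrite expr1; apply: turan_extrapolate1 am.
have shift k : \sum_j b j * z j ^+ k.+1 = \sum_j (b j * z j) * z j ^+ k.
  by apply: eq_bigr => j _; rewrite exprS mulrA.
have aS k : (k <= N + M)%N ->
    sqnormc (\sum_j b j * z j ^+ k.+1) <= (10 ^+ M) ^+ N.+1 * m.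
  move=> kNM; rewrite shift; apply: IH kNM => l lM.
  by rewrite -shift -addSn; exact: am.
have p1 : 1 <= 10 ^+ M :> R by rewrite exprn_ege1// ler1n.
have p0 : 0 <= (10 ^+ M) ^+ N.+1 * m by rewrite mulr_ge0// !exprn_ge0.
move=> [_|k kNM]; rewrite exprS -mulrA.
  under eq_bigr do rewrite expr0 mulr1.
  apply: turan_extrapolate1 => // -[//|k] /= kM; apply: aS.
  by rewrite (leq_trans (ltnW kM))// leq_addl.
by rewrite (le_trans (aS k kNM))// ler_peMl.
Qed.

End Turan.

(** * Exponential sums along progressions and affine changes of variable on the line *)

Section RealLine.
Context {R : realType}.
Local Notation mu := (@lebesgue_measure R).

Definition cis (t : R) : R[i] := Complex (cos t) (sin t).

Lemma sqnormc_cis t : sqnormc (cis t) = 1.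
Proof. by rewrite sqnormcE cos2Dsin2. Qed.

Lemma cisD s t : cis (s + t) = cis s * cis t.
Proof. by rewrite /cis cosD sinD; congr Complex; rewrite addrC. Qed.

Lemma cisMn t n : cis (n%:R * t) = cis t ^+ n.
Proof.
elim: n => [|n IH]; first by rewrite mul0r /cis cos0 sin0.
by rewrite -addn1 natrD mulrDl mul1r cisD IH exprD expr1.
Qed.

(* The sample of q at x + k h is a power sum in the unimodular cis (a j * h). *)
Lemma cis_sum_extrapolate M N (b : 'I_M -> R[i]) (a : 'I_M -> R) (x h m : R) :
  let q t := \sum_j b j * cis (a j * t) in
  0 <= m ->
  (forall k, (0 < k <= M)%N -> sqnormc (q (x + (N + k)%:R * h)) <= m) ->
  sqnormc (q x) <= (10 ^+ M) ^+ N.+1 * m.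
Proof.
move=> q m0 qm.
have qE n : q (x + n%:R * h) =
    \sum_j (b j * cis (a j * x)) * cis (a j * h) ^+ n.
  apply: eq_bigr => j _; rewrite -mulrA -cisMn -cisD; congr (_ * cis _); ring.
rewrite -[x in q x](addr0 x) -(mul0r h) -[0](_ : 0%:R = 0)// qE.
apply: (@turan_extrapolate _ _ N) => // [j|k kM]; first exact: sqnormc_cis.
by rewrite -qE; exact: qm.
Qed.

(** By uniqueness of Lebesgue measure: the pushforward of [mu] under the affine map, scaled by [v],
    gives half-open intervals their length. *)
Lemma lebesgue_measure_affine (u v : R) (B : set (measurableTypeR R)) : 0 < v ->
  measurable B -> mu B = (v%:E * mu ((fun t => (u + v * t)%R) @^-1` B))%E.
Proof.
move=> v0 mB; pose f (t : measurableTypeR R) : measurableTypeR R := u + v * t.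
have mf : measurable_fun setT f.
  by apply: measurable_funD => //; exact: measurable_funM.
pose pf : {measure set (measurableTypeR R) -> \bar R} :=
  measure_function_pushforward__canonical__measure_function_Measure mu mf.
pose nu := mscale (NngNum (ltW v0)) pf.
rewrite (@lebesgue_measure_unique _ nu)// => _ [[s t] /= _ <-].
rewrite /nu/= /mscale/= /pushforward.
have -> : f @^-1` `]s, t]%classic = `](s - u) / v, (t - u) / v]%classic.
  apply/seteqP; split => y /=; rewrite !in_itv/= /f;
  by rewrite ltr_pdivrMr// ler_pdivlMr// ltrBlDl lerBrDl [y * v]mulrC.
rewrite !lebesgue_measure_itv/= !lte_fin ltr_pM2r ?invr_gt0// ltrD2r.
case: ifP => _; last by rewrite mule0.
by rewrite -!EFinB -EFinM; congr EFin; field; rewrite gt_eqF.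
Qed.

Lemma le_lebesgue_measure_affine (u v : R) (B : set (measurableTypeR R)) :
  1 <= v -> measurable B -> (mu ((fun t => (u + v * t)%R) @^-1` B) <= mu B)%E.
Proof.
move=> v1 mB; rewrite [leRHS](@lebesgue_measure_affine u v)//; last first.
  by rewrite (lt_le_trans ltr01).
by rewrite lee_pemull// lee_fin.
Qed.

End RealLine.

(** * Measurability of exponential sums and the Markov inequality *)

Lemma measurable_sqnormc_cis_sum (R : realType) d (T : measurableType d) M
    (c : 'I_M -> R[i]) (f : 'I_M -> T -> R) :
  (forall j, measurable_fun setT (f j)) ->
  measurable_fun setT (fun x => sqnormc (\sum_j c j * cis (f j x))).
Proof.
move=> mf; under eq_fun do rewrite sqnormcE.
have mcos j : measurable_fun setT (fun x => cos (f j x)).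
  exact: measurableT_comp (continuous_measurable_fun (@continuous_cos R)) (mf j).
have msin j : measurable_fun setT (fun x => sin (f j x)).
  exact: measurableT_comp (continuous_measurable_fun (@continuous_sin R)) (mf j).
suff : measurable_fun setT (fun x => complex.Re (\sum_j c j * cis (f j x))) /\
       measurable_fun setT (fun x => complex.Im (\sum_j c j * cis (f j x))).
  by move=> -[mRe mIm]; apply: measurable_funD; exact: measurable_funX.
elim: M c f mf mcos msin => [|M IH] c f mf mcos msin.
  by split; under eq_fun do rewrite big_ord0; exact: measurable_cst.
have [mRe mIm] := IH (fun j => c (lift ord0 j)) (fun j => f (lift ord0 j))
  (fun j => mf _) (fun j => mcos _) (fun j => msin _).
split; under eq_fun do rewrite big_ord_recl.
- under eq_fun do rewrite raddfD/=.
  apply: measurable_funD mRe; case: (c ord0) => u v /=.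
  by apply: measurable_funB; apply: measurable_funM => //; exact: measurable_cst.
- under eq_fun do rewrite raddfD/=.
  apply: measurable_funD mIm; case: (c ord0) => u v /=.
  by apply: measurable_funD; apply: measurable_funM => //; exact: measurable_cst.
Qed.

Lemma markov_ge0 (R : realType) d (T : measurableType d)
    (mu : {measure set T -> \bar R}) (W : set T) (g : T -> R) (m : R) :
  measurable W -> measurable_fun setT g -> (forall t, 0 <= g t) -> 0 < m ->
  (m%:E * mu (W `&` [set t | (m <= g t)%R]) <= \int[mu]_(t in W) (g t)%:E)%E.
Proof.
move=> mW mg g0 m0.
have mWg : measurable_fun W (EFin \o g).
  exact/measurable_EFinP/(measurable_funS _ _ mg).
have := @le_integral_comp_abse _ _ _ mu W mW (EFin \o g) m idfun
  (@measurable_id _ _ _) (fun r r0 => r0) (fun _ _ _ _ h => h) mWg m0.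
rewrite /= (_ : [set x | _] = [set t | m <= g t]); last first.
  by apply/seteqP; split => t /=; rewrite lee_fin ger0_norm.
by under eq_integral do rewrite ger0_norm//.
Qed.

(** * A Remez-type inequality on an interval *)

Section Interval.
Context {R : realType}.
Local Notation mu := (@lebesgue_measure R).

(* The sample point [x + (N + k) h] of the progression started at [x] and
   aimed at the midpoint of [`]a, b[] is an affine function of slope [>= 1] of
   the offset [t]; so the offsets sending it to a bad set have measure at most
   that of the bad set. *)
Lemma interval_progression M (a b L : R) : a < b ->
  exists N : nat, forall (B : set (measurableTypeR R)), measurable B ->
    (mu B <= ((b - a) / (4 * M.+1%:R))%:E)%E ->
    forall x, `|x| <= L -> exists h, forall k, (0 < k <= M)%N ->
      (`]a, b[ `\` B) (x + (N + k)%:R * h).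
Proof.
move=> ab; pose l := b - a; pose c := (a + b) / 2.
have l0 : 0 < l by rewrite subr_gt0.
(* After [n] steps the progression reaches [c + t], with total displacement at most [D]; [n] is
   taken so large that the next [M] steps move it by less than [l / 4]. *)
pose D := `|c| + `|L| + l; pose n := (Num.trunc (4 * D * M%:R / l)).+1.
have nD : D * M%:R / n%:R < l / 4.
  have := truncnS_gt (4 * D * M%:R / l); rewrite -/n => nlt.
  have n0 : (0 : R) < n%:R by rewrite ltr0n.
  rewrite ltr_pdivrMr// mulrAC ltr_pdivlMr//.
  by move: nlt; rewrite ltr_pdivrMr// => nlt; rewrite mulrC mulrA (mulrC l).
have n0 : (0 : R) < n%:R by rewrite ltr0n.
exists n => B mB muB x xL.
pose v k : R := (n + k)%:R / n%:R.
have v1 k : 1 <= v k by rewrite ler_pdivlMr// mul1r ler_nat leq_addr.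
pose f k t := (x + v k * (c - x)) + v k * t.
pose U := \big[setU/set0]_(k < M) (f k.+1 @^-1` B).
have mU k : measurable (f k @^-1` B).
  rewrite -[X in measurable X]setTI.
  suff : measurable_fun setT (f k : measurableTypeR R -> measurableTypeR R).
    by move=> mf; exact: mf.
  by apply: measurable_funD => //; exact: measurable_funM.
(* There are [M] sets of bad offsets, each of measure at most [l / (4 * M.+1%:R)]; the factor [M.+1]
   makes the total strictly less than [l / 4], so a good offset is left in []0, l / 4[]. *)
have muU : (mu U < (l / 4)%:E)%E.
  apply: (@le_lt_trans _ _ (\sum_(k < M) (l / (4 * M.+1%:R))%:E)%E).
    apply: (le_trans (@Boole_inequality _ _ _ mu (fun k => f k.+1 @^-1` B) M _)).
      by move=> k _; exact: mU.
    apply: lee_sum => k _; apply: le_trans muB.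
    exact: le_lebesgue_measure_affine.
  rewrite sumEFin lte_fin sumr_const card_ord -(mulr_natr (l / _)).
  have M1 : (0 : R) < M.+1%:R by rewrite ltr0n.
  rewrite mulrAC ltr_pdivrMr ?mulr_gt0// mulrA divfK// ltr_pM2l//.
  by rewrite ltr_nat.
have [t [t0 tU]] : exists t, (`]0, l / 4[%classic : set R) t /\ ~ U t.
  apply: contrapT => H.
  have : (mu `]0%R, (l / 4)%R[%classic <= mu U)%E.
    apply: le_measure; rewrite ?inE//=.
      by apply: bigsetU_measurable => k _; exact: mU.
    by move=> t t0; apply: contrapT => Ut; apply: H; exists t.
  apply/negP; rewrite -ltNge (lt_le_trans muU)// lebesgue_measure_itv/= lte_fin.
  by rewrite divr_gt0// oppr0 adde0.
exists ((c - x + t) / n%:R) => k /andP[k0 kM].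
have -> : x + (n + k)%:R * ((c - x + t) / n%:R) = f k t.
  by rewrite /f /v; field; rewrite gt_eqF.
split; last first.
  move=> fB; apply: tU; rewrite /U -(bigcup_mkord M (fun k => f k.+1 @^-1` B)).
  by exists k.-1; rewrite /= prednK.
move: t0; rewrite /= !in_itv/= => /andP[t0 tl].
have fE : f k t = c + t + (c - x + t) * k%:R / n%:R.
  by rewrite /f /v natrD; field; rewrite gt_eqF.
have : `|(c - x + t) * k%:R / n%:R| < l / 4.
  apply: le_lt_trans nD; rewrite !normrM normfV !normr_nat ler_pM2r ?invr_gt0//.
  rewrite ler_pM ?ler_nat//.
  rewrite /D (le_trans (ler_normD _ _))// lerD//; last first.
    rewrite ger0_norm ?ltW//; move: tl l0; lra.
  rewrite (le_trans (ler_normB _ _))// lerD// (le_trans xL)// ler_norm//.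
by rewrite ltr_norml fE /c; move: tl t0; rewrite /l; lra.
Qed.

(** The measure allowance of [interval_progression] is halved: one half for the points outside [W],
    the other for the points of [W] where [q] is at least a level [m]. A progression that avoids
    both samples [q] below [m]. *)
Lemma interval_remez M (a b L : R) : a < b ->
  exists2 C : R, 0 < C & forall W : set (measurableTypeR R), measurable W ->
    (mu (`]a, b[ `\` W) <= ((b - a) / (8 * M.+1%:R))%:E)%E ->
    forall (c : 'I_M -> R[i]) (w : 'I_M -> R) (x : R),
    let q t := sqnormc (\sum_j c j * cis (w j * t)) in
    `|x| <= L -> ((q x)%:E <= C%:E * \int[mu]_(t in W) (q t)%:E)%E.
Proof.
move=> ab; have [N HN] := interval_progression M L ab.
(* [K^-1] is half of the allowance and [A] is the extrapolation constant. *)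
pose K : R := 8 * M.+1%:R / (b - a); pose A : R := (10 ^+ M) ^+ N.+1.
have ba0 : 0 < b - a by rewrite subr_gt0.
have K0 : 0 < K by rewrite divr_gt0// mulr_gt0// ltr0n.
have A0 : 0 < A by rewrite !exprn_gt0.
exists (A * K) => [|W mW muW c w x q xL]; first exact: mulr_gt0.
have q0 t : 0 <= q t by exact: sqnormc_ge0.
have mq : measurable_fun setT (q : measurableTypeR R -> R).
  by apply: measurable_sqnormc_cis_sum => j; exact: measurable_funM.
have I0 : (0 <= \int[mu]_(t in W) (q t)%:E)%E.
  by apply: integral_ge0 => t _; rewrite lee_fin.
case IE : (\int[mu]_(t in W) (q t)%:E)%E I0 => [I| |]// I0; last first.
  by rewrite gt0_muley ?leey// lte_fin mulr_gt0.
(* The excess [e] keeps the level [m] positive when the integral vanishes, as the Markov inequality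
   requires. *)
rewrite -EFinM lee_fin; apply/ler_addgt0Pr => e e0.
pose m := (I + e / (A * K)) * K.
have m0 : 0 < m.
  by rewrite mulr_gt0// ltr_wpDl// divr_gt0// mulr_gt0.
have -> : A * K * I + e = A * m by rewrite /m; field; rewrite !gt_eqF.
pose B := (`]a, b[ `\` W) `|` (W `&` [set t | m <= q t]).
have mWm : measurable (W `&` [set t | m <= q t] : set (measurableTypeR R)).
  apply: measurableI => //; rewrite -[X in measurable X]setTI.
  exact: measurable_fun_le.
have mB : measurable (B : set (measurableTypeR R)).
  by apply: measurableU => //; exact: measurableD.
have muB : (mu B <= ((b - a) / (4 * M.+1%:R))%:E)%E.
  apply: (le_trans (measureU2 _ _ _)) => //; first exact: measurableD.
  have -> : (b - a) / (4 * M.+1%:R) = (b - a) / (8 * M.+1%:R) + K^-1.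
    by rewrite /K; field; rewrite gt_eqF//= lt0r_neq0// ltr0n.
  rewrite EFinD leeD//.
  have := markov_ge0 mu mW mq q0 m0; rewrite IE -lee_pdivlMl//.
  move=> /le_trans; apply; rewrite -EFinM lee_fin.
  rewrite mulrC ler_pdivrMr// /m mulrC mulfK ?gt_eqF//.
  by rewrite lerDl divr_ge0 ?ltW// mulr_gt0.
have [h hB] := HN B mB muB x xL.
apply: (@cis_sum_extrapolate _ _ _ _ _ _ h); first exact: ltW.
move=> k kM; have [abk nBk] := hB k kM; rewrite leNgt; apply/negP => mk.
apply: nBk; have [Wk|nWk] := pselect (W (x + (N + k)%:R * h)).
  by right; split => //=; rewrite ltW.
by left.
Qed.

End Interval.

(** * Lebesgue density and null sets in products *)

Section Density.
Context {R : realType}.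
Local Notation mu := (@lebesgue_measure R).

(** Near a density point [x] of [A], a small ball of radius [r] misses [A] in measure less than
    [k * r]. Rational endpoints within [r / 2] of the ends of the ball give an interval inside it
    that is longer than [r]. *)
Lemma dense_rat_interval (A : set (measurableTypeR R)) (k : R) :
  measurable A -> (0 < mu A)%E -> 0 < k ->
  exists p q : rat, p < q /\
    (mu (`]ratr p, ratr q[ `\` A) <= (k * (ratr q - ratr p))%:E)%E.
Proof.
move=> mA A0 k0.
have [x [Ax xl]] : exists x, A x /\
    (mu (A `&` ball x r) / mu (ball x r))%E @[r --> 0^'+] --> 1%E.
  apply: contrapT => noA; move: A0; rewrite lt0e => /andP[/eqP + _]; apply.
  apply: measure_negligible => //; apply: negligibleS (lebesgue_density mA).
  move=> x Ax /= xl; apply: noA; exists x; split=> //.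
  by move: xl; rewrite indicE mem_set.
have : \forall r \near (0 : R)^'+,
    ((1 - k / 2)%:E < mu (A `&` ball x r) / mu (ball x r))%E.
  apply: (xl [set y | ((1 - k / 2)%:E < y)%E]); apply: open_ereal_gt'.
  by rewrite lte_fin; move: k0; lra.
move=> near_r.
have [r [r0 rl]] : exists r, 0 < r /\
    ((1 - k / 2)%:E < mu (A `&` ball x r) / mu (ball x r))%E.
  have /filter_ex[r [? ?]] : \forall r \near (0 : R)^'+, 0 < r /\
      ((1 - k / 2)%:E < mu (A `&` ball x r) / mu (ball x r))%E.
    by apply: filterI near_r; exact: nbhs_right_gt.
  by exists r.
have [p] := @rat_in_itvoo R (x - r) (x - r / 2) ltac:(lra).
rewrite in_itv/= => /andP[p1 p2].
have [q] := @rat_in_itvoo R (x + r / 2) (x + r) ltac:(lra).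
rewrite in_itv/= => /andP[q1 q2].
exists p, q; split; first by rewrite -(@ltr_rat R); lra.
have mb : measurable (ball x r : set (measurableTypeR R)).
  exact: measurable_ball.
have mub : mu (ball x r) = (r *+ 2)%:E.
  by apply: lebesgue_measure_ball; exact: ltW.
apply: (@le_trans _ _ (mu (ball x r `\` A))).
  apply: le_measure; rewrite ?inE; try exact: measurableD.
  apply: setSD => y /=; rewrite in_itv/= => /andP[y1 y2].
  by rewrite /ball/= ltr_distlC; apply/andP; split; lra.
have sum : (mu (ball x r) = mu (ball x r `\` A) + mu (A `&` ball x r))%E.
  rewrite -measureU//.
  - by congr mu; rewrite setIC setUC setUIDK.
  - exact: measurableD.
  - exact: measurableI.
  - by rewrite -subset0 => y [[_ nA] [Ay _]].
move: rl sum; rewrite mub.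
have fD : mu (ball x r `\` A) \is a fin_num.
  rewrite ge0_fin_numE//; apply: le_lt_trans (_ : (mu (ball x r) < +oo)%E).
    by apply: le_measure; rewrite ?inE//; exact: measurableD.
  by rewrite mub ltry.
have fI : mu (A `&` ball x r) \is a fin_num.
  rewrite ge0_fin_numE//; apply: le_lt_trans (_ : (mu (ball x r) < +oo)%E).
    by apply: le_measure; rewrite ?inE//; exact: measurableI.
  by rewrite mub ltry.
rewrite -(fineK fD) -(fineK fI) inver mulrn_eq0/= gt_eqF// -EFinM -EFinD.
rewrite lte_fin lee_fin => + -[].
rewrite ltr_pdivlMr ?mulrn_wgt0// -(mulr_natr r) => h1 h2.
nra.
Qed.

End Density.

(** The product measure is also the iterated integral over [y] of the measures of the sections, and
    here that integrand vanishes almost everywhere. *)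
Lemma product_measure_ysection0 d1 d2 (T1 : measurableType d1)
    (T2 : measurableType d2) (R : realType)
    (m1 : {sigma_finite_measure set T1 -> \bar R})
    (m2 : {sigma_finite_measure set T2 -> \bar R}) (V : set (T1 * T2)) :
  measurable V -> m2.-negligible [set y | (0 < m1 (ysection V y))%E] ->
  (m1 \x m2)%E V = 0%E.
Proof.
move=> mV V0.
rewrite (@product_measure_unique _ _ _ _ _ _ _ (m1 \x^ m2)%E)//; last first.
  by move=> A B mA mB; exact: product_measure2E.
change (\int[m2]_y (m1 \o ysection V) y = 0)%E.
rewrite (ae_eq_integral (cst 0%E))//.
- by rewrite integral_cst// mul0e.
- exact: measurable_fun_ysection.
- apply: negligibleS V0 => y /= /not_implyP[_ /eqP].
  by rewrite lt0e => -> /=; exact: measure_ge0.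
Qed.

(** * The Remez-type inequality in several variables *)

Section ExponentialSums.
Context {R : realType}.
Local Notation mu := (@lebesgue_measure R).
Local Notation tupR d := (d.-tuple (measurableTypeR R)).

Definition expsum d M (c : 'I_M -> R[i]) (xi : 'I_M -> tupR d) (x : tupR d) :
    R[i] :=
  \sum_j c j * cis (\sum_i tnth (xi j) i * tnth x i).

Lemma tnth_behead_lift d (x : tupR d.+1) i :
  tnth [tuple of behead x] i = tnth x (lift ord0 i).
Proof.
case/tupleP: x => t y; rewrite tnthS; congr tnth; exact: val_inj.
Qed.

(** For the induction on the dimension, with [t] frozen; the companion [expsum_consl] freezes [y]
    instead, for the one-dimensional inequality. *)
Lemma expsum_cons d M (c : 'I_M -> R[i]) (xi : 'I_M -> tupR d.+1) t y :
  expsum c xi (cons_pair (t, y)) =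
  expsum (fun j => c j * cis (tnth (xi j) ord0 * t))
         (fun j => [tuple of behead (xi j)]) y.
Proof.
apply: eq_bigr => j _; rewrite big_ord_recl cisD mulrA; congr (_ * cis _).
by apply: eq_bigr => i _; rewrite tnthS tnth_behead_lift.
Qed.

Lemma expsum_consl d M (c : 'I_M -> R[i]) (xi : 'I_M -> tupR d.+1) t y :
  expsum c xi (cons_pair (t, y)) =
  \sum_j (c j * cis (\sum_i tnth (xi j) (lift ord0 i) * tnth y i)) *
    cis (tnth (xi j) ord0 * t).
Proof.
apply: eq_bigr => j _; rewrite big_ord_recl addrC cisD mulrA.
congr (_ * cis _ * _).
by apply: eq_bigr => i _; rewrite tnthS.
Qed.

Lemma measurable_sqnormc_expsum d M (c : 'I_M -> R[i]) (xi : 'I_M -> tupR d) :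
  measurable_fun setT (fun x : tupR d => sqnormc (expsum c xi x)).
Proof.
apply: measurable_sqnormc_cis_sum => j; apply: measurable_sum => i.
by apply: measurable_funM => //; exact: measurable_tnth.
Qed.

(** The point is moved in two stages. The induction hypothesis, with the first coordinate of [x]
    frozen, replaces the other coordinates by base points [y]; for each such [y], [interval_remez]
    then replaces the first coordinate by points of the slice of [V]. *)
Lemma expsum_remez M (L : R) d (V : set (tupR d)) :
  measurable V -> (0 < borel_lebesgue d V)%E ->
  exists2 C : R, 0 < C & forall (c : 'I_M -> R[i]) (xi : 'I_M -> tupR d) x,
    (forall i, `|tnth x i| <= L) ->
    ((sqnormc (expsum c xi x))%:E <=
       C%:E * \int[borel_lebesgue d]_(y in V) (sqnormc (expsum c xi y))%:E)%E.
Proof.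
elim: d V => [|d IH] V mV V0.
  (* In dimension 0 the measure is the point mass at the empty tuple, which [V] contains because it
     is not null. *)
  exists 1 => // c xi x _.
  rewrite mul1e /= integral_dirac//; last first.
    apply/measurable_EFinP; apply: measurable_funTS.
    exact: measurable_sqnormc_expsum.
  move: V0; rewrite /= diracE; case: (_ \in V) => [_|]; last by rewrite ltxx.
  by rewrite mul1e (tuple0 x).
pose V' : set (measurableTypeR R * tupR d) := @cons_pair R d @^-1` V.
have mV' : measurable V'.
  by rewrite -[X in measurable X]setTI; exact: measurable_cons_pair.
have V'0 : (0 < (mu \x borel_lebesgue d) V')%E := V0.
(* [k] is the fraction of an interval that a set may miss in [interval_remez]; [A] collects the base
   points whose slices meet this condition on a given rational interval. *)
pose k : R := (8 * M.+1%:R)^-1.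
have k0 : 0 < k by rewrite invr_gt0 mulr_gt0// ltr0n.
pose A (pq : rat * rat) : set (tupR d) :=
  [set y | (mu (`]ratr pq.1, ratr pq.2[ `\` ysection V' y) <=
            (k * (ratr pq.2 - ratr pq.1))%:E)%E].
have mA pq : measurable (A pq).
  pose Z : set (measurableTypeR R * tupR d) :=
    (`]ratr pq.1, ratr pq.2[ `*` setT) `\` V'.
  have mZ : measurable Z by apply: measurableD => //; exact: measurableX.
  have -> : A pq = [set: _] `&` [set y | (mu (ysection Z y) <=
      (k * (ratr pq.2 - ratr pq.1))%:E)%E].
    rewrite setTI; apply/seteqP; split => y; rewrite /A/= ysectionD;
    by rewrite (_ : ysection (_ `*` _) y = `]ratr pq.1, ratr pq.2[%classic)//;
      apply/seteqP; split => t; rewrite /ysection/= inE/=; tauto.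
  by apply: emeasurable_fun_infty_c => //; exact: measurable_fun_ysection.
(* If [A pq] were null for all proper intervals, so would be their countable union, which contains
   every [y] with a slice of positive measure; then [V'] would be null. *)
have [[p q] /= pq Apq] : exists2 pq : rat * rat, pq.1 < pq.2 &
    (0 < borel_lebesgue d (A pq))%E.
  apply: contrapT => noA; move: V'0.
  rewrite product_measure_ysection0 ?ltxx//.
  pose F n : set (tupR d) := if unpickle n is Some pq then
    (if (pq : rat * rat).1 < pq.2 then A pq else set0) else set0.
  apply: (@negligibleS _ _ _ _ (\bigcup_n F n)); last first.
    apply: negligible_bigcup => n; rewrite /F.
    case: (unpickle n) => [pq|]; last exact: negligible_set0.
    case: ifPn => pq12; last exact: negligible_set0.
    apply/negligibleP; first exact: mA.
    apply: contrapT => /eqP A0; apply: noA; exists pq => //.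
    by rewrite lt0e A0 measure_ge0.
  move=> y /= y0.
  have [|p [q [pq Apq]]] := @dense_rat_interval R (ysection V' y) k _ y0 k0.
    exact: measurable_ysection.
  exists (pickle (p, q)); first exact: I.
  by rewrite /F pickleK ifT; [exact: Apq|exact: pq].
have [C1 C10 HC1] := IH _ (mA (p, q)) Apq.
have pqR : ratr p < ratr q :> R by rewrite ltr_rat.
have [C2 C20 HC2] := interval_remez M L pqR.
exists (C1 * C2) => [|c xi x xL]; first exact: mulr_gt0.
pose G (z : measurableTypeR R * tupR d) : \bar R :=
  (sqnormc (expsum c xi (cons_pair z)))%:E.
have mG : measurable_fun setT G.
  apply/measurable_EFinP.
  exact: (measurableT_comp (measurable_sqnormc_expsum c xi)
    (@measurable_cons_pair R d)).
have G0 z : (0 <= G z)%E by rewrite lee_fin sqnormc_ge0.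
have GV0 z : (0 <= (G \_ V') z)%E by rewrite /patch; case: ifP.
have mGV : measurable_fun setT (G \_ V').
  by apply/(measurable_restrictT _ mV'); exact: measurable_funTS.
(* Tonelli, with the integral over the first coordinate inside. *)
have -> : (\int[borel_lebesgue d.+1]_(y in V) (sqnormc (expsum c xi y))%:E =
    \int[borel_lebesgue d]_y \int[mu]_t (G \_ V') (t, y))%E.
  rewrite -(fubini_tonelli2 _ mGV GV0) -integral_mkcond.
  apply: (ge0_integral_pushforward (@measurable_cons_pair R d) _ mV
    (f := fun y => (sqnormc (expsum c xi y))%:E)).
    apply/measurable_EFinP; apply: measurable_funTS.
    exact: measurable_sqnormc_expsum.
  by move=> y _; rewrite lee_fin sqnormc_ge0.
have xE : x = cons_pair (thead x, [tuple of behead x]).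
  by rewrite /cons_pair [LHS]tuple_eta.
rewrite [in leLHS]xE expsum_cons.
apply: (le_trans (HC1 _ _ _ _)).
  by move=> i; rewrite tnth_behead_lift; exact: xL.
rewrite EFinM -muleA lee_pmul2l//.
have mH : measurable_fun setT (fun y => \int[mu]_t (G \_ V') (t, y))%E.
  exact: (measurable_fun_fubini_tonelli_G _ mGV GV0).
rewrite -ge0_integralZl//; last 2 first.
- by move=> y _; apply: integral_ge0.
- by rewrite lee_fin ltW.
rewrite [leLHS]integral_mkcond.
apply: ge0_le_integral => //.
- by move=> y _; rewrite /patch; case: ifP => // _; rewrite lee_fin sqnormc_ge0.
- apply/(measurable_restrictT _ (mA _)); apply: measurable_funTS.
  by apply/measurable_EFinP; exact: measurable_sqnormc_expsum.
- exact: measurable_funeM.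
(* Off [A] the left-hand integrand is 0; on [A] the slice satisfies the hypothesis of [HC2], applied
   at the first coordinate of [x]. *)
move=> y _; rewrite [leLHS]/patch; case: ifPn => [|_]; last first.
  by apply: mule_ge0; [rewrite lee_fin ltW|apply: integral_ge0].
rewrite inE => Ay; rewrite -expsum_cons expsum_consl.
have mVy : measurable (ysection V' y) by exact: measurable_ysection.
have Ay' := Ay; rewrite /A/= mulrC in Ay'.
apply: (le_trans (HC2 _ mVy Ay' _ _ _ (xL ord0))).
rewrite lee_pmul2l// integral_mkcond.
rewrite le_eqVlt (eq_integral (fun t => (G \_ V') (t, y))) ?eqxx// => t _.
rewrite /patch mem_ysection; case: ifP => // _.
by rewrite /G expsum_consl.
Qed.

End ExponentialSums.

(** * From Borel sets to bounded Lebesgue measurable sets *)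

Section EuclideanTransfer.
Context {R : realType} {d : nat}.
Local Notation tupR := (d.-tuple (measurableTypeR R)).
Local Notation leb := (lebesgue R d).

Lemma measurable_euclidean_id :
  measurable_fun setT (idfun : euclidean R d -> tupR).
Proof.
by move=> _ A mA; rewrite setTI; exact: caratheodory_measurable_mu_ext.
Qed.

Definition ebox (L : R) : set tupR :=
  [set t | forall i, `[- L, L]%classic (tnth t i)].

Lemma measurable_ebox L : measurable (ebox L).
Proof.
exact: (@measurable_box R d (fun=> `[- L, L]%classic) (fun=> measurable_itv _)).
Qed.

Lemma lebesgue_ebox_lty L : (leb (ebox L) < +oo)%E.
Proof.
rewrite (@lebesgue_box R d (fun=> `[- L, L]%classic) (fun=> measurable_itv _)).
have : (lebesgue_measure (`[(- L)%R, L]%classic : set (measurableTypeR R)) < +oo)%E.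
  by rewrite lebesgue_measure_itv/=; case: ifP => _; rewrite ltry.
rewrite -ge0_fin_numE// => fL; rewrite -(fineK fL) prodEFin; exact: ltry.
Qed.

Lemma ebounded_ebox (A : set (euclidean R d)) : ebounded A ->
  exists L, A `<=` ebox L.
Proof.
move=> [L AL]; exists L => x Ax i; rewrite /= in_itv/= -ler_norml; exact: AL.
Qed.

Lemma ebounded_lty (A : set (euclidean R d)) : measurable A -> ebounded A ->
  (leb A < +oo)%E.
Proof.
move=> mA /ebounded_ebox[L AL]; apply: le_lt_trans (lebesgue_ebox_lty L).
apply: le_measure; rewrite ?inE//.
exact: caratheodory_measurable_mu_ext (measurable_ebox L).
Qed.

(** The part of a box outside [V] has smaller outer measure than the box, so countably many Borel
    sets of smaller total measure cover it; what they leave of the box lies in [V] and is not null.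
    This lets [expsum_remez], stated for Borel sets, serve Lebesgue measurable ones. *)
Lemma borel_inner_gt0 (V : set (euclidean R d)) : measurable V -> ebounded V ->
  (0 < leb V)%E ->
  exists W : set tupR, [/\ measurable W, W `<=` V & (0 < borel_lebesgue d W)%E].
Proof.
move=> mV /ebounded_ebox[L VL] V0.
have mB : measurable (ebox L : set (euclidean R d)).
  exact: caratheodory_measurable_mu_ext (measurable_ebox L).
have : (leb (ebox L `\` V) < leb (ebox L))%E.
  have -> : (leb (ebox L) = leb (ebox L `\` V) + leb V)%E.
    rewrite addeC -measureU//; last 2 first.
    - exact: measurableD.
    - by rewrite setDIK.
    by rewrite setDUK.
  rewrite lteDl// ge0_fin_numE//; apply: le_lt_trans (lebesgue_ebox_lty L).
  by apply: le_measure; rewrite ?inE//; exact: measurableD.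
move=> /ereal_inf_lt[_ [F [mF coverF] <-]].
rewrite [leb _](measurable_mu_extE _ (measurable_ebox L)) => FB.
have mU : measurable (\bigcup_k F k) by exact: bigcupT_measurable.
exists (ebox L `\` \bigcup_k F k); split.
- by apply: measurableD => //; exact: measurable_ebox.
- by move=> x [Bx Ux]; apply: contrapT => Vx; apply: Ux; apply: coverF.
rewrite lt0e measure_ge0 andbT; apply/eqP => W0.
move: FB; apply/negP; rewrite -leNgt.
apply: (@le_trans _ _ (borel_lebesgue d (\bigcup_k F k))).
  rewrite -[leRHS]adde0 -W0; apply: le_trans (measureU2 _ _ _) => //.
    apply: le_measure; rewrite ?inE//=.
    - exact: measurable_ebox.
    - by apply: measurableU => //; apply: measurableD => //; exact: measurable_ebox.
    by move=> x Bx; have [|] := pselect ((\bigcup_k F k) x); [left|right].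
  by apply: measurableD => //; exact: measurable_ebox.
exact: measure_sigma_subadditive.
Qed.

(* Convertible to [expsum], on the completed measurable space. *)
Definition planewave_sum M (c : 'I_M -> R[i]) (xi : 'I_M -> euclidean R d)
  (x : euclidean R d) : R[i] := \sum_(j < M) c j * planewave (xi j) x.

Lemma measurable_sqnormc_planewave_sum M (c : 'I_M -> R[i])
    (xi : 'I_M -> euclidean R d) :
  measurable_fun setT (fun x => sqnormc (planewave_sum c xi x)).
Proof.
exact: (measurableT_comp (measurable_sqnormc_expsum c xi)
  measurable_euclidean_id).
Qed.

(** The pushforward of [lebesgue] under the identity agrees with [borel_lebesgue] on Borel sets; the
    rest is monotonicity in the domain. *)
Lemma le_integral_borel_lebesgue (W : set tupR) (V : set (euclidean R d))
    (g : tupR -> R) : measurable W -> measurable V -> W `<=` V ->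
  measurable_fun setT g -> (forall x, 0 <= g x) ->
  (\int[borel_lebesgue d]_(y in W) (g y)%:E <= \int[leb]_(y in V) (g y)%:E)%E.
Proof.
move=> mW mV WV mg g0.
pose leb' : {measure set tupR -> \bar R} :=
  measure_function_pushforward__canonical__measure_function_Measure leb
    measurable_euclidean_id.
rewrite (@eq_measure_integral _ _ _ _ leb'); last first.
  by move=> A mA _; rewrite /leb'/= /pushforward; exact/esym/measurable_mu_extE.
apply: (@le_trans _ _ (\int[leb]_(y in W) (g y)%:E)%E).
  rewrite le_eqVlt; apply/orP; left; apply/eqP.
  apply: (ge0_integral_pushforward measurable_euclidean_id _ mW
    (f := fun y => (g y)%:E)).
    by apply/measurable_EFinP; exact: measurable_funTS.
  by move=> y _; rewrite lee_fin.
apply: ge0_subset_integral => //.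
- exact: caratheodory_measurable_mu_ext.
- apply/measurable_EFinP/measurable_funTS.
  exact: (measurableT_comp mg measurable_euclidean_id).
- by move=> x _; rewrite lee_fin.
Qed.

(** The pointwise bound of [expsum_remez], for a Borel part [W] of [V], is integrated over [Omega],
    whose measure is finite. *)
Lemma planewave_sum_concentration (Omega V : set (euclidean R d)) M :
  measurable Omega -> ebounded Omega -> measurable V -> V `<=` Omega ->
  (0 < leb V)%E ->
  exists2 g : R, 0 < g & forall c (xi : 'I_M -> euclidean R d),
    (g%:E * sqL2norm leb Omega (planewave_sum c xi) <=
     sqL2norm leb V (planewave_sum c xi))%E.
Proof.
move=> mO bO mV VO V0; have bV : ebounded V.
  by case: bO => L OL; exists L => x /VO; exact: OL.
have [W [mW WV W0]] := borel_inner_gt0 mV bV V0.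
have [L OL] := bO.
have [C C0 HC] := expsum_remez M L mW W0.
have fO : leb Omega \is a fin_num by rewrite ge0_fin_numE//; exact: ebounded_lty.
pose m := fine (leb Omega); have m0 : 0 <= m by exact: fine_ge0.
(* Integration over [Omega] costs a factor [m]; [m + 1] is positive from [0 <= m] alone. *)
exists (C * (m + 1))^-1 => [|c xi].
  by rewrite invr_gt0 mulr_gt0// ltr_wpDl.
have Cm0 : 0 < C * (m + 1) by rewrite mulr_gt0// ltr_wpDl.
rewrite lee_pdivrMl// {1}/sqL2norm.
have I0 : (0 <= sqL2norm leb V (planewave_sum c xi))%E.
  by apply: integral_ge0 => x _; rewrite lee_fin sqnormc_ge0.
apply: (@le_trans _ _ (\int[leb]_(x in Omega)
    cst (C%:E * sqL2norm leb V (planewave_sum c xi)) x)%E).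
  apply: ge0_le_integral => //.
  - by move=> x _; rewrite lee_fin sqnormc_ge0.
  - by apply/measurable_EFinP/measurable_funTS/measurable_sqnormc_planewave_sum.
  move=> x Ox; apply: (le_trans (HC c xi x (OL x Ox))).
  rewrite lee_pmul2l//; apply: le_integral_borel_lebesgue => //.
    exact: measurable_sqnormc_expsum.
  by move=> y; exact: sqnormc_ge0.
rewrite integral_cst// -(fineK fO) -/m muleAC -EFinM.
by apply: lee_wpmul2r => //; rewrite lee_fin ler_pM2l// lerDl.
Qed.

End EuclideanTransfer.

(** * Classes in L^2 and their representatives *)

Section L2classes.
Local Open Scope quotient_scope.
Context {d : measure_display} {T : measurableType d} {R : realType}.
Variables (mu : {measure set T -> \bar R}) (D : set T) (mD : measurable D).
Local Notation LD := (L2 mu mD).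

Lemma L2_to_fun_pi (f : L2fun mu mD) : ((\pi_LD f : LD) : T -> R[i]) = f %[ae mu in D].
Proof.
have : repr (\pi_LD f : LD) - f \in @L2null _ _ _ mu D mD.
  by rewrite Quotient.idealrBE reprK.
rewrite inE; apply: filterS => x + Dx => /(_ Dx).
by move=> /eqP; rewrite subr_eq0 => /eqP.
Qed.

Lemma L2_to_fun0 : ((0 : LD) : T -> R[i]) = (fun=> 0) %[ae mu in D].
Proof.
have E0 : (0 : LD) = \pi_LD 0 by rewrite raddf0.
by have := L2_to_fun_pi 0; rewrite -E0.
Qed.

Lemma L2_to_funD (u v : LD) :
  ((u + v : LD) : T -> R[i]) = (fun x => u x + v x) %[ae mu in D].
Proof.
have uvE : u + v = \pi_LD (repr u + repr v) by rewrite L2_piD !reprK.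
by have := L2_to_fun_pi (repr u + repr v); rewrite -uvE.
Qed.

Lemma L2_to_fun_sum (I : finType) (r : I -> LD) (p : I -> T -> R[i]) :
  (forall i, (r i : T -> R[i]) = p i %[ae mu in D]) ->
  ((\sum_i r i : LD) : T -> R[i]) = (fun x => \sum_i p i x) %[ae mu in D].
Proof.
move=> rp.
have : ((\sum_i r i : LD) : T -> R[i]) = \sum_i p i %[ae mu in D].
  apply: (big_ind2 (fun (u : LD) (f : T -> R[i]) =>
    (u : T -> R[i]) = f %[ae mu in D])) => [|u f v g uf vg|i _]; last exact: rp.
    exact: L2_to_fun0.
  apply: filterS3 (L2_to_funD u v) uf vg => x + + + Dx.
  by move=> /(_ Dx) -> /(_ Dx) -> /(_ Dx) ->.
by apply: filterS => x + Dx => /(_ Dx) ->; rewrite fct_sumE.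
Qed.

Lemma measurable_sqnormc_L2 (u : LD) : measurable_fun D (fun x => sqnormc (u x)).
Proof.
have : L2fun_val (repr u) \in L2pred mu mD by exact: valP.
rewrite inE => -[mRe mIm _]; under eq_fun do rewrite sqnormcE.
by apply: measurable_funD; exact: measurable_funX.
Qed.

(** With it the norms of a class are computed from an explicit plane-wave sum, whichever
    representative the coercion picks. *)
Lemma sqL2norm_ae (V : set T) (u : LD) (p : T -> R[i]) :
  measurable V -> V `<=` D -> measurable_fun V (fun x => sqnormc (p x)) ->
  (u : T -> R[i]) = p %[ae mu in D] -> sqL2norm mu V u = sqL2norm mu V p.
Proof.
move=> mV VD mp up; apply: ge0_ae_eq_integral => //.
- apply/measurable_EFinP; apply: measurable_funS (measurable_sqnormc_L2 u) => //.
- exact/measurable_EFinP.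
- by move=> x _; rewrite lee_fin sqnormc_ge0.
- by move=> x _; rewrite lee_fin sqnormc_ge0.
by apply: filterS up => x + Vx => /(_ (VD _ Vx)) ->.
Qed.

End L2classes.

(** * Plane-wave complexity of sums of subspaces *)

Section Complexity.
Context {R : realType} {d : nat}.
Variables (Omega : set (euclidean R d)) (mOmega : measurable Omega).
Local Notation L2 := (L2 (lebesgue R d) mOmega).

(* Any finite family of at most [M] frequencies can be listed as [M]
   frequencies, the unused slots receiving zero coefficients. *)
Lemma planewave_reindex (J : finType) (M : nat) (xi : J -> euclidean R d) :
  (#|J| <= M)%N ->
  exists zeta : 'I_M -> euclidean R d, forall c : J -> R[i],
    exists c' : 'I_M -> R[i], forall x,
      \sum_j c j * planewave (xi j) x = planewave_sum c' zeta x.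
Proof.
move=> JM; pose h j : 'I_M := widen_ord JM (enum_rank j).
have h_inj : injective h 
  by move=> i j /(congr1 val)/= ij; apply: enum_rank_inj; exact: val_inj.
pose g i := [pick j | h j == i].
have gh j : g (h j) = Some j.
  rewrite /g; case: pickP => [k /eqP/h_inj ->//|/(_ j)]; by rewrite eqxx.
(* The default [point] is the frequency of an empty slot, whose coefficient is an empty sum. *)
exists (fun i => oapp xi point (g i)) => c.
exists (fun i => \sum_(j | h j == i) c j) => x.
rewrite /planewave_sum (partition_big h xpredT)//=; apply: eq_bigr => i _.
by rewrite mulr_suml; apply: eq_bigr => j /eqP <-; rewrite gh.
Qed.

Lemma planewave_span_widen (N M : nat) (xi : 'I_N -> euclidean R d) :
  (N <= M)%N -> exists zeta : 'I_M -> euclidean R d,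
    planewave_span (mOmega := mOmega) xi `<=` planewave_span zeta.
Proof.
move=> NM; have [|zeta Hz] := @planewave_reindex 'I_N M xi.
  by rewrite card_ord.
exists zeta => u [c uc]; have [c' cc'] := Hz c; exists c'.
by apply: filterS uc => x + Dx => /(_ Dx) ->.
Qed.

(** The infimum runs over natural numbers, so a bound by [M] yields an admissible [N] below [M.+1];
    its frequencies are then padded to [M]. *)
Lemma planewave_complexity_leP (E : set L2) (M : nat) :
  (planewave_complexity E <= M%:R%:E)%E <->
  exists xi : 'I_M -> euclidean R d, E `<=` planewave_span xi.
Proof.
split=> [EM|[xi Exi]]; last first.
  by apply: ereal_inf_lbound; exists M => //; exists xi.
have : (planewave_complexity E < M.+1%:R%:E)%E.
  by rewrite (le_lt_trans EM)// lte_fin ltr_nat.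
move=> /ereal_inf_lt[_ [N [xi Exi] <-]]; rewrite lte_fin ltr_nat ltnS => NM.
have [zeta xz] := planewave_span_widen xi NM.
by exists zeta; apply: subset_trans xz.
Qed.

(** The frequencies are indexed by pairs of a mode and one of its [N] slots, at most [N * K] pairs
    in all. *)
Lemma planewave_complexity_sum (I : finType) (F : I -> set L2) (K N : nat) :
  (#|I| <= K)%N -> (forall i, (planewave_complexity (F i) <= N%:R%:E)%E) ->
  (planewave_complexity (sum_of_subspaces F) <= (N * K)%N%:R%:E)%E.
Proof.
move=> IK FN; apply/planewave_complexity_leP.
have /choice[xi Fxi] : forall i, exists xi : 'I_N -> euclidean R d,
    F i `<=` planewave_span xi.
  by move=> i; exact/planewave_complexity_leP.
have [|zeta Hz] := @planewave_reindex (I * 'I_N)%type (N * K)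
    (fun ij => xi ij.1 ij.2).
  by rewrite card_prod card_ord mulnC leq_mul2l IK orbT.
exists zeta => _ [r [Fr ->]].
have /choice[c rc] := fun i => Fxi i _ (Fr i).
have [c' cc'] := Hz (fun ij => c ij.1 ij.2); exists c'.
apply: filterS (L2_to_fun_sum rc) => x + Dx => /(_ Dx) ->.
by rewrite pair_bigA; exact: cc'.
Qed.

End Complexity.

(** * Uniform complexity and concentration for the family *)

Theorem corollary3p4 (R : realType) (d : nat) :
  exists gamma : set (euclidean R d) -> set (euclidean R d) -> nat -> R,
  forall (Omega : set (euclidean R d)) (mOmega : measurable Omega),
    ebounded Omega -> (0 < lebesgue R d Omega)%E ->
    (forall (V : set (euclidean R d)) (M : nat),
       measurable V -> V `<=` Omega -> (0 < lebesgue R d V)%E -> (1 <= M)%N ->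
       0 < gamma Omega V M)
    /\
    forall (Sigma : Type)
      (E : Sigma -> submodClosed (L2 (lebesgue R d) mOmega))
      (K Nmod : nat)
      (I : Sigma -> finType)
      (modes : forall l : Sigma, I l -> submodClosed (L2 (lebesgue R d) mOmega)),
      (forall l, finite_dimensional [set` E l]) ->
      (1 <= K)%N -> (1 <= Nmod)%N ->
      (forall l, [set` E l] = sum_of_subspaces (fun c : I l => [set` modes l c])) ->
      (forall l, (#|I l| <= K)%N) ->
      (forall l (c : I l),
         (planewave_complexity [set` modes l c] <= Nmod%:R%:E)%E) ->
      (forall l, (planewave_complexity [set` E l] <= (Nmod * K)%N%:R%:E)%E)
      /\
      (forall V : set (euclidean R d),
         measurable V -> V `<=` Omega -> (0 < lebesgue R d V)%E ->
         forall (l : Sigma) (u : L2 (lebesgue R d) mOmega), u \in E l ->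
           (sqL2norm (lebesgue R d) V u >=
              (gamma Omega V (Nmod * K)%N)%:E * sqL2norm (lebesgue R d) Omega u)%E).
Proof.
(* The constant is chosen for each triple of [Omega], [V] and [M] before any family is given, so it
   cannot depend on the family; triples outside the hypotheses receive the default 0. *)
have /choice[gamma Hg] : forall OVM : set (euclidean R d) * set (euclidean R d) * nat,
    exists g : R, measurable OVM.1.1 -> ebounded OVM.1.1 -> measurable OVM.1.2 ->
      OVM.1.2 `<=` OVM.1.1 -> (0 < lebesgue R d OVM.1.2)%E ->
      0 < g /\ forall c (xi : 'I_OVM.2 -> euclidean R d),
        (g%:E * sqL2norm (lebesgue R d) OVM.1.1 (planewave_sum c xi) <=
         sqL2norm (lebesgue R d) OVM.1.2 (planewave_sum c xi))%E.
  move=> [[A V] M] /=.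
  have [[mO bO mV VO V0]|nH] := pselect [/\ measurable A, ebounded A,
      measurable V, V `<=` A & (0 < lebesgue R d V)%E]; last first.
    by exists 0 => *; case: nH; split.
  have [g g0 Hg] := planewave_sum_concentration M mO bO mV VO V0.
  by exists g.
exists (fun Omega V M => gamma (Omega, V, M)) => Omega mOmega bO O0; split.
  by move=> V M mV VO V0 _; have [] := Hg (Omega, V, M) mOmega bO mV VO V0.
move=> Sigma E K Nmod I modes _ _ _ Esum IK modesN.
have EN l : (planewave_complexity [set` E l] <= (Nmod * K)%N%:R%:E)%E.
  by rewrite Esum; exact: planewave_complexity_sum.
split=> // V mV VO V0 l u uE.
(* [u] is almost everywhere on [Omega] a sum of [Nmod * K] plane waves, so both norms are those of
   that sum. *)
have /planewave_complexity_leP[xi Exi] := EN l.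
have [c uc] := Exi u uE.
have mp (A : set (euclidean R d)) :
    measurable_fun A (fun x => sqnormc (planewave_sum c xi x)).
  exact/measurable_funTS/measurable_sqnormc_planewave_sum.
rewrite (sqL2norm_ae mV VO (mp V) uc) (sqL2norm_ae mOmega _ (mp Omega) uc)//.
by have [_] := Hg (Omega, V, (Nmod * K)%N) mOmega bO mV VO V0; exact.
Qed.
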